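(* Let $r,f_1,\dots,f_n,g_1,\dots,g_n:\mathbb{R}^d\to\mathbb{R}\cup\{\infty\}$ be convex, closed, and proper. Assume $f_1,\dots,f_n$ are differentiable and have $L$-Lipschitz continuous gradients. Assume the Lagrangian $\mathcal{L}$ (defined in the context) has a saddle point, and let $0<\alpha<3/(2L)$. Let $(\mathbf{z}^k)_{k\ge 0}$, $(x^{k+1/2})_{k\ge0}$, $(x_i^{k+1})_{k\ge 0}$ be generated by the method (PPG) of the context from an arbitrary starting point $\mathbf{z}^0\in\mathbb{R}^{dn}$. Then $\|p(\mathbf{z}^k)\|_2\to 0$ monotonically with rate $$\|p(\mathbf{z}^k)\|_2\le \mathcal{O}(1/\sqrt{k}).$$ Furthermore, $\mathbf{z}^k\to\mathbf{z}^\star$, $x^{k+1/2}\to x^\star$, and $x_i^{k+1}\to x^\star$ for all $i=1,\dots,n$, where $\mathbf{z}^\star$ is some fixed point of (PPG) and $x^\star$ is some solution of the problem $\text{minimize}_{x\in\mathbb{R}^d}\; r(x)+\frac1n\sum_{i=1}^n (f_i(x)+g_i(x))$.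
   Context: For a convex, closed, proper $h$, $\mathrm{prox}_h(x_0)=\operatorname{argmin}_x\{h(x)+\frac12\|x-x_0\|_2^2\}$. Boldface denotes tuples of $n$ vectors of $\mathbb{R}^d$: $\mathbf{z}=(z_1,\dots,z_n)\in\mathbb{R}^{dn}$, $\bar z=\frac1n\sum_i z_i$. (PPG), with stepsize $\alpha>0$: $x^{k+1/2}=\mathrm{prox}_{\alpha r}\big(\frac1n\sum_{i=1}^n z_i^k\big)$; for all $i=1,\dots,n$, $x_i^{k+1}=\mathrm{prox}_{\alpha g_i}\big(2x^{k+1/2}-z_i^k-\alpha\nabla f_i(x^{k+1/2})\big)$ and $z_i^{k+1}=z_i^k+x_i^{k+1}-x^{k+1/2}$. The mapping $p:\mathbb{R}^{dn}\to\mathbb{R}^{dn}$ is $(p(\mathbf{z}))_i=(1/\alpha)(x-x_i')$, where $x=\mathrm{prox}_{\alpha r}(\bar z)$ and $x_i'=\mathrm{prox}_{\alpha g_i}(2x-z_i-\alpha\nabla f_i(x))$. Thus (PPG) reads $\mathbf{z}^{k+1}=\mathbf{z}^k-\alpha p(\mathbf{z}^k)$, and $\mathbf{z}$ is a fixed point iff $p(\mathbf{z})=0$. The Lagrangian is $\mathcal{L}(x,\mathbf{x},\boldsymbol{\nu})=r(x)+\frac1n\sum_{i=1}^n (f_i(x_i)+g_i(x_i))+\frac1n\sum_{i=1}^n\nu_i^T(x_i-x)$, for $x\in\mathbb{R}^d$, $\mathbf{x},\boldsymbol{\nu}\in\mathbb{R}^{dn}$; a saddle point is minimal in $(x,\mathbf{x})$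 and maximal in $\boldsymbol{\nu}$. $\mathcal{O}(\cdot)$ is as $k\to\infty$, with constants independent of $k$. *)

(* Defs.v *)
From HB Require Import structures.
From mathcomp Require Import all_boot all_order all_algebra.
From mathcomp Require Import all_classical all_reals all_analysis.

Set Implicit Arguments.
Unset Strict Implicit.
Unset Printing Implicit Defensive.

Import Order.TTheory GRing.Theory Num.Theory.
Import numFieldNormedType.Exports.

Local Open Scope classical_set_scope.
Local Open Scope ring_scope.

(* A tuple of n vectors of R^d is a matrix 'M[R]_(n, d), whose i-th row is the
   i-th vector. The norm that MathComp-Analysis puts on matrices is the sup
   norm, hence [norm2] below. The topology on matrices, used for convergence
   and differentiability, is the same for both norms. *)

Section Euclidean.
Context {R : realType}.

Definition dot {d} (u v : 'rV[R]_d) : R := \sum_(j < d) u 0 j * v 0 j.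

Definition norm2 {m d} (A : 'M[R]_(m, d)) : R :=
  Num.sqrt (\sum_(i < m) \sum_(j < d) A i j ^+ 2).

Definition mean {n d} (z : 'M[R]_(n, d)) : 'rV[R]_d :=
  n%:R^-1 *: \sum_(i < n) row i z.

Definition gradient {d} (F : 'rV[R]_d -> R) (x : 'rV[R]_d) : 'rV[R]_d :=
  \row_(j < d) 'D_(delta_mx 0 j) F x.

End Euclidean.

Section ExtendedRealFunctions.
Context {R : realType} {d : nat}.
Local Open Scope ereal_scope.

Implicit Types h f : 'rV[R]_d -> \bar R.

Definition proper_fun h : Prop :=
  (forall x, h x != -oo) /\ (exists x, h x < +oo).

(* For functions that avoid -oo, the right-hand side is never of the
   form +oo - oo. *)
Definition convex_fun h : Prop :=
  forall (x y : 'rV[R]_d) (t : R), (0 < t < 1)%R ->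
    h (t *: x + (1 - t) *: y)%R <= t%:E * h x + (1 - t)%:E * h y.

Definition closed_fun h : Prop :=
  closed [set q : 'rV[R]_d * R | h q.1 <= q.2%:E].

Definition ccp h : Prop := [/\ convex_fun h, closed_fun h & proper_fun h].

(* Differentiability at every point of R^d includes finiteness. *)
Definition differentiable_fun f : Prop :=
  forall x, f x \is a fin_num /\ differentiable (fine \o f) x.

Definition grad f : 'rV[R]_d -> 'rV[R]_d := gradient (fine \o f).

Definition lipschitz_grad (L : R) f : Prop :=
  forall x y, (norm2 (grad f x - grad f y) <= L * norm2 (x - y))%R.

(* Empty when F is identically +oo. *)
Definition argmin (F : 'rV[R]_d -> \bar R) : set 'rV[R]_d :=
  [set x | F x < +oo /\ forall y, F x <= F y].

(* [get] chooses an element of the set, which is a singleton when h is convex,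
   closed and proper. *)
Definition prox h (x0 : 'rV[R]_d) : 'rV[R]_d :=
  get (argmin (fun x => h x + (2^-1 * norm2 (x - x0) ^+ 2)%:E)).

End ExtendedRealFunctions.

Section PPG.
Context {R : realType} {d n : nat}.
Variables (r : 'rV[R]_d -> \bar R) (f g : 'I_n -> 'rV[R]_d -> \bar R).

Definition objective (x : 'rV[R]_d) : \bar R :=
  (r x + (n%:R^-1)%:E * \sum_(i < n) (f i x + g i x))%E.

Definition lagrangian (x : 'rV[R]_d) (xs nu : 'M[R]_(n, d)) : \bar R :=
  (r x + (n%:R^-1)%:E * (\sum_(i < n) (f i (row i xs) + g i (row i xs)))
   + (n%:R^-1 * \sum_(i < n) dot (row i nu) (row i xs - x))%:E)%E.

Definition saddle_point (x : 'rV[R]_d) (xs nu : 'M[R]_(n, d)) : Prop :=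
  (forall y ys, (lagrangian x xs nu <= lagrangian y ys nu)%E) /\
  (forall mu, (lagrangian x xs mu <= lagrangian x xs nu)%E).

Variable alpha : R.

Definition prox_r (v : 'rV[R]_d) : 'rV[R]_d :=
  prox (fun y => alpha%:E * r y)%E v.

Definition prox_g (i : 'I_n) (v : 'rV[R]_d) : 'rV[R]_d :=
  prox (fun y => alpha%:E * g i y)%E v.

(* One iteration: [z] is z^k, [xh] is x^{k+1/2}, and [x'], [z'] are the tuples
   (x_i^{k+1})_i and z^{k+1}. *)
Definition ppg_iteration (z : 'M[R]_(n, d)) (xh : 'rV[R]_d)
    (x' z' : 'M[R]_(n, d)) : Prop :=
  xh = prox_r (mean z) /\
  forall i,
    row i x' = prox_g i (2 *: xh - row i z - alpha *: grad (f i) xh) /\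
    row i z' = row i z + row i x' - xh.

(* In [xs], the index k stands for (x_i^k)_i; the entry [xs 0] is unused. *)
Definition ppg_generated (z : nat -> 'M[R]_(n, d)) (xh : nat -> 'rV[R]_d)
    (xs : nat -> 'M[R]_(n, d)) : Prop :=
  forall k, ppg_iteration (z k) (xh k) (xs k.+1) (z k.+1).

Definition ppg_fixed_point (z : 'M[R]_(n, d)) : Prop :=
  exists xh x', ppg_iteration z xh x' z.

Definition ppg_p (z : 'M[R]_(n, d)) : 'M[R]_(n, d) :=
  let x := prox_r (mean z) in
  \matrix_(i < n)
    (alpha^-1 *: (x - prox_g i (2 *: x - row i z - alpha *: grad (f i) x))).

End PPG.

(* Main.v *)
Require Import Defs.
From HB Require Import structures.
From mathcomp Require Import all_boot all_order all_algebra.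
From mathcomp Require Import all_classical all_reals all_analysis.
From mathcomp Require Import ring lra.

Set Implicit Arguments.
Unset Strict Implicit.
Unset Printing Implicit Defensive.

Import Order.TTheory GRing.Theory Num.Theory.
Import numFieldNormedType.Exports.

Local Open Scope classical_set_scope.
Local Open Scope ring_scope.

(** The method is three operator splitting in disguise. Replace a point [x] by the
    tuple of its copies; then averaging, followed by the proximal map of [r], is
    the resolvent of the consensus problem, and the proximal maps of the
    [g i] act block by block. One iteration is a map [T] on tuples, with
    [z - T z = alpha *: ppg_p z].

    [T] is averaged: [|T z - T w|^2 <= |z - w|^2 - c * |(z - T z) - (w - T w)|^2]
    with [c = 1 - alpha * L / 2], which is positive. Proximal maps are firmly
    nonexpansive ([prox_firmly_nonexpansive]), gradient steps are cocoercive by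
    the theorem of Baillon and Haddad ([gradient_cocoercive]), and adding these
    inequalities gives the claim ([three_operator_contraction],
    [split_next_averaged]). Since [prox] picks a minimizer by choice, all this
    rests on the existence of a minimizer, which comes from compactness of balls
    and coercivity ([prox_nonempty]).

    The optimality conditions of a saddle point [(x, nu)] say that [mean nu] is a
    subgradient of [r] and that [- (grad (f i) x + nu_i)] is one of [g i]; hence
    the tuple with rows [x + alpha * nu_i] is fixed by [T]
    ([saddle_point_residual_eq0]). Conversely, at a fixed point the subgradients
    produced by the proximal maps sum to zero, so the associated [x] solves the
    minimization problem ([residual_eq0_argmin]).

    The rest is the classical argument for averaged maps with a fixed point: the
    residual is nonincreasing because [T] is nonexpansive, its squares are
    summable by telescoping, so [k * |z_k - T z_k|^2] stays bounded
    ([residual_summable]); any cluster point of the bounded sequence of iterates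
    is fixed, and the distance to it is nonincreasing, so the whole sequence
    converges ([averaged_converges]). *)

(** * The Euclidean structure on tuples of vectors *)

Section Inner.
Context {R : realType} {m d : nat}.
Implicit Types A B C : 'M[R]_(m, d).

(** The Frobenius inner product: [norm2] is its norm, and on row vectors it is
    [dot]. *)
Definition inner A B : R := \sum_(i < m) \sum_(j < d) A i j * B i j.

Lemma innerC A B : inner A B = inner B A.
Proof.
by apply: eq_bigr => i _; apply: eq_bigr => j _; rewrite mulrC.
Qed.

Lemma innerDl A B C : inner (A + B) C = inner A C + inner B C.
Proof.
rewrite /inner -big_split; apply: eq_bigr => i _ /=.
by rewrite -big_split; apply: eq_bigr => j _ /=; rewrite mxE mulrDl.
Qed.

Lemma innerZl a A B : inner (a *: A) B = a * inner A B.
Proof.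
rewrite /inner mulr_sumr; apply: eq_bigr => i _; rewrite mulr_sumr.
by apply: eq_bigr => j _; rewrite mxE mulrA.
Qed.

Lemma innerNl A B : inner (- A) B = - inner A B.
Proof. by rewrite -scaleN1r innerZl mulN1r. Qed.

Lemma innerBl A B C : inner (A - B) C = inner A C - inner B C.
Proof. by rewrite innerDl innerNl. Qed.

Lemma innerDr A B C : inner C (A + B) = inner C A + inner C B.
Proof. by rewrite innerC innerDl !(innerC C). Qed.

Lemma innerZr a A B : inner A (a *: B) = a * inner A B.
Proof. by rewrite innerC innerZl innerC. Qed.

Lemma innerNr A B : inner A (- B) = - inner A B.
Proof. by rewrite innerC innerNl innerC. Qed.

Lemma innerBr A B C : inner C (A - B) = inner C A - inner C B.
Proof. by rewrite innerDr innerNr. Qed.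

Lemma inner0r A : inner A 0 = 0.
Proof. by rewrite -(scale0r 0) innerZr mul0r. Qed.

Definition innerE :=
  (innerDl, innerDr, innerBl, innerBr, innerNl, innerNr, innerZl, innerZr).

Lemma inner_ge0 A : 0 <= inner A A.
Proof. by do 2![apply: sumr_ge0 => ? _]; rewrite -expr2 sqr_ge0. Qed.

Lemma norm2_sqr A : norm2 A ^+ 2 = inner A A.
Proof.
rewrite sqr_sqrtr; last by do 2![apply: sumr_ge0 => ? _]; rewrite sqr_ge0.
by do 2![apply: eq_bigr => ? _]; rewrite expr2.
Qed.

Lemma norm2_ge0 A : 0 <= norm2 A.
Proof. exact: sqrtr_ge0. Qed.

Lemma norm2Z a A : norm2 (a *: A) = `|a| * norm2 A.
Proof.
apply/eqP; rewrite -(@eqrXn2 _ 2) // ?mulr_ge0 ?norm2_ge0 //.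
by rewrite norm2_sqr !innerE exprMn norm2_sqr real_normK ?num_real // expr2 mulrA.
Qed.

Lemma norm2N A : norm2 (- A) = norm2 A.
Proof. by rewrite -scaleN1r norm2Z normrN1 mul1r. Qed.

Lemma norm2B A B : norm2 (A - B) = norm2 (B - A).
Proof. by rewrite -norm2N opprB. Qed.

Lemma entry_le_norm2 A i j : `|A i j| <= norm2 A.
Proof.
rewrite -(@ler_pXn2r _ 2) ?nnegrE ?norm2_ge0 // norm2_sqr real_normK ?num_real //.
rewrite /inner (bigD1 i) //= (bigD1 j) //= -expr2 -addrA lerDl.
by rewrite addr_ge0 //; do ?[apply: sumr_ge0 => ? _]; rewrite -expr2 sqr_ge0.
Qed.

Lemma norm_le_norm2 A : `|A| <= norm2 A.
Proof.
rewrite [leLHS]/Num.norm /= mx_normrE; apply/bigmax_leP; split.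
  exact: norm2_ge0.
by move=> [i j] _; exact: entry_le_norm2.
Qed.

Lemma entry_le_norm A i j : `|A i j| <= `|A|.
Proof.
rewrite [leRHS]/Num.norm /= mx_normrE.
exact: (le_bigmax _ (fun ij : 'I_m * 'I_d => `|A ij.1 ij.2|) (i, j)).
Qed.

(** The Euclidean norm is at most [Num.sqrt (m * d)] times the sup norm, so both
    norms define the same convergence. *)
Lemma norm2_le_norm A : norm2 A <= Num.sqrt (m * d)%:R * `|A|.
Proof.
rewrite -(@ler_pXn2r _ 2) ?nnegrE ?norm2_ge0 ?mulr_ge0 ?sqrtr_ge0 //.
rewrite norm2_sqr exprMn sqr_sqrtr // natrM -mulrA.
apply: le_trans (_ : \sum_(i < m) \sum_(j < d) `|A| ^+ 2 <= _).
  apply: ler_sum => i _; apply: ler_sum => j _.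
  rewrite -expr2 -(@real_normK _ (A i j)) ?num_real //.
  by rewrite ler_pXn2r ?nnegrE // entry_le_norm.
by rewrite !(sumr_const, card_ord) !mulr_natl.
Qed.

Lemma norm2_eq0 A : norm2 A = 0 -> A = 0.
Proof. by move=> A0; apply/eqP; rewrite -normr_le0 -A0 norm_le_norm2. Qed.

Lemma cauchy_schwarz A B : inner A B <= norm2 A * norm2 B.
Proof.
have [/norm2_eq0 ->|a0] := eqVneq (norm2 A) 0.
  by rewrite innerC inner0r mulr_ge0 ?norm2_ge0.
have [/norm2_eq0 ->|b0] := eqVneq (norm2 B) 0.
  by rewrite inner0r mulr_ge0 ?norm2_ge0.
have apos : 0 < norm2 A by rewrite lt_neqAle eq_sym a0 norm2_ge0.
have bpos : 0 < norm2 B by rewrite lt_neqAle eq_sym b0 norm2_ge0.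
(* This square is twice [norm2 A * norm2 B] times the gap to be proved. *)
have := inner_ge0 (norm2 B *: A - norm2 A *: B).
rewrite !innerE -!norm2_sqr (innerC B A).
move: (norm2 A) (norm2 B) (inner A B) apos bpos => a b c apos bpos h.
have : 0 <= 2 * (a * b) * (a * b - c).
  by apply: le_trans h _; rewrite le_eqVlt; apply/orP; left; apply/eqP; ring.
by rewrite pmulr_rge0 ?mulr_gt0 // subr_ge0.
Qed.

Lemma norm2D A B : norm2 (A + B) <= norm2 A + norm2 B.
Proof.
rewrite -(@ler_pXn2r _ 2) ?nnegrE ?addr_ge0 ?norm2_ge0 //.
rewrite norm2_sqr !innerE -!norm2_sqr (innerC B A).
have := cauchy_schwarz A B; lra.
Qed.

End Inner.

(** * Compactness in finite dimension *)

Lemma norm2_cvg {R : realType} m d (u : nat -> 'M[R]_(m, d)) (l : 'M[R]_(m, d)) :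
  (forall e, 0 < e -> exists N, forall k, (N <= k)%N -> norm2 (u k - l) < e) ->
  u @ \oo --> l.
Proof.
move=> h; apply/cvgrPdist_lt => e /h[N hN].
near=> k; apply: le_lt_trans (norm_le_norm2 _) _.
by rewrite norm2B; apply: hN; near: k; exists N.
Unshelve. all: by end_near. Qed.

Lemma closed_ball_compact {R : realType} d (c : 'rV[R]_d) (e : R) :
  compact (closed_ball_ Num.norm c e).
Proof.
apply: bounded_closed_compact; last exact: closed_closed_ball_.
exists (e + `|c|); split; first exact: num_real.
move=> M lt_M x /= xe; apply: le_trans (ltW lt_M).
by rewrite -[x](subrK c) (le_trans (ler_normD _ _)) // lerD2r distrC.
Qed.

Lemma norm2_mxvec {R : realType} m d (A : 'M[R]_(m, d)) :
  norm2 (mxvec A) = norm2 A.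
Proof.
congr Num.sqrt; rewrite big_ord1 pair_big /=.
rewrite (reindex _ (curry_mxvec_bij _ _)) /=.
by apply: eq_bigr => -[i j] _ /=; rewrite mxvecE.
Qed.

(** Bolzano-Weierstrass, by compactness of closed balls of flattened matrices. *)
Lemma norm2_bounded_cluster {R : realType} m d (u : nat -> 'M[R]_(m, d)) (M : R) :
  (forall k, norm2 (u k) <= M) ->
  exists l, forall e, 0 < e -> forall N, exists2 k, (N <= k)%N & norm2 (u k - l) < e.
Proof.
move=> uM.
have [l [_ cl]] : closed_ball_ Num.norm 0 M `&`
    cluster ((fun k => mxvec (u k)) @ \oo) !=set0.
  apply: closed_ball_compact.
  exists 0%N => // k _ /=; rewrite /closed_ball_ /= sub0r normrN.
  by rewrite (le_trans (norm_le_norm2 _)) // norm2_mxvec.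
exists (vec_mx l) => e e0 N.
(* One is added so that the factor between the two norms is positive even for
   an empty index set. *)
pose c : R := Num.sqrt (1 * (m * d))%:R + 1.
have c0 : 0 < c by rewrite ltr_wpDl // sqrtr_ge0.
have [] := cl [set mxvec (u k) | k in [set k | (N <= k)%N]] (ball l (e / c)).
- by exists N => // k /= Nk; exists k.
- by apply: nbhsx_ballx; rewrite divr_gt0.
move=> _ [[k /= Nk <-]]; rewrite -ball_normE /= => lt_e; exists k => //.
rewrite -norm2_mxvec linearB /= vec_mxK norm2B.
apply: le_lt_trans (norm2_le_norm _) _.
apply: le_lt_trans (_ : c * `|l - mxvec (u k)| < _).
  by rewrite ler_wpM2r // lerDl.
by rewrite mulrC -ltr_pdivlMr.
Qed.

(** * Lower semicontinuous functions *)

Section LowerSemicontinuous.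
Context {T : topologicalType} {R : realType}.
Implicit Types h : T -> \bar R.

(** The sublevel sets of [h] inside [K] form a filter base; a cluster point
    of that filter lies below every value of [h] on [K]. *)
Lemma lsc_compact_min h (K : set T) :
  lower_semicontinuous h -> compact K -> K !=set0 ->
  exists2 x, K x & forall y, K y -> (h x <= h y)%E.
Proof.
move=> lsc cK [x0 Kx0].
pose F := filter_from K (fun y => K `&` [set x | (h x <= h y)%E]).
have FF : ProperFilter F.
  apply: filter_from_proper; last by move=> y Ky; exists y; split => /=.
  apply: filter_from_filter; first by exists x0.
  move=> y1 y2 Ky1 Ky2; have [le12|lt21] := leP (h y1) (h y2).
    by exists y1 => // x [Kx /= hx]; split; split => //=; exact: le_trans le12.
  exists y2 => // x [Kx /= hx]; split; split => //=.
  exact: le_trans (ltW lt21).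
have [x [Kx clx]] : K `&` cluster F !=set0.
  by apply: cK; exists x0 => // x [].
exists x => // y Ky; rewrite leNgt; apply/negP => lt_yx.
have [a ya ax] : exists2 a : R, (h y <= a%:E)%E & (a%:E < h x)%E.
  case: (h x) (h y) lt_yx => [b| |] [a| |] //=.
  - by move=> ab; exists a.
  - by move=> _; exists (b - 1); rewrite ?leNye // lte_fin gtrBl.
  - by move=> _; exists a => //; exact: ltry.
  - by move=> _; exists 0; rewrite ?leNye ?ltry.
have [V xV aV] := lsc x a ax.
have FKy : F (K `&` [set x | (h x <= h y)%E]) by exists y.
have [w [[_ /= hw] Vw]] := clx _ _ FKy xV.
by have := lt_le_trans (aV w Vw) (le_trans hw ya); rewrite ltxx.
Qed.

Lemma lscD_continuous h (q : T -> R) :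
  lower_semicontinuous h -> continuous q ->
  lower_semicontinuous (fun x => h x + (q x)%:E)%E.
Proof.
move=> lsc cq x a; case hx: (h x) => [b| |] //=.
- rewrite -EFinD lte_fin => ab.
  pose e := (b + q x - a) / 2.
  have e0 : 0 < e by rewrite divr_gt0 // subr_gt0.
  have [|V xV bV] := lsc x (b - e); first by rewrite hx lte_fin gtrBl.
  exists (V `&` [set y | `|q x - q y| < e]).
    apply: filterI => //.
    exact: (cvgrPdist_lt _ _).1 (cq x) e e0.
  move=> y [/bV + /=]; rewrite ltr_norml => + /andP[_].
  case: (h y) => [c| |] //=; rewrite ?ltry // -?EFinD !lte_fin /e; lra.
- move=> _.
  have [|V xV bV] := lsc x (a - q x + 1); first by rewrite hx ltry.
  exists (V `&` [set y | `|q x - q y| < 1]).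
    apply: filterI => //.
    exact: (cvgrPdist_lt _ _).1 (cq x) 1 ltr01.
  move=> y [/bV + /=]; rewrite ltr_norml => + /andP[_].
  case: (h y) => [c| |] //=; rewrite ?ltry // -?EFinD !lte_fin; lra.
Qed.

End LowerSemicontinuous.

(** If [a < h x], a product neighbourhood of [(x, a)] avoids the epigraph. *)
Lemma closed_fun_lsc {R : realType} d (h : 'rV[R]_d -> \bar R) :
  closed_fun h -> lower_semicontinuous h.
Proof.
move=> clh x a ax.
have /(_ (x, a)) : open (~` [set q : 'rV[R]_d * R | (h q.1 <= q.2%:E)%E]).
  exact: closed_openC.
rewrite /= => /(_ _)[]; first by apply/negP; rewrite -ltNge.
move=> [A B] /= [xA aB] AB; exists A => // y Ay.
rewrite ltNge; apply/negP.
exact: (AB (y, a) (conj Ay (nbhs_singleton aB))).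
Qed.

(** * Subgradients and proximal points *)

(** Divide by [t] and let [t] tend to 0; this isolates the linear term of an
    optimality condition along a segment. *)
Lemma le0_of_quadratic {R : realType} (c b : R) :
  (forall t, 0 < t < 1 -> t * c <= t ^+ 2 * b) -> c <= 0.
Proof.
move=> h; rewrite leNgt; apply/negP => c0.
(* At [t = c / (2 * (|b| + c + 1))] the right-hand side is below [t * c]. *)
have D0 : 0 < 2 * (`|b| + c + 1) by rewrite mulr_gt0 // addr_gt0 // ltr_wpDl.
have t0 : 0 < c / (2 * (`|b| + c + 1)) by rewrite divr_gt0.
have := h (c / (2 * (`|b| + c + 1))).
rewrite t0 expr2 -mulrA ler_pM2l // => /(_ _)/wrap[].
  by rewrite ltr_pdivrMr // mul1r; have := normr_ge0 b; lra.
rewrite leNgt mulrAC ltr_pdivrMr // => /negP; apply.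
rewrite ltr_pM2l //.
by have := ler_norm b; have := normr_ge0 b; lra.
Qed.

Section Subgradient.
Context {R : realType} {d : nat}.
Implicit Types (h : 'rV[R]_d -> \bar R) (x y v s : 'rV[R]_d).

Definition subgrad h x s : Prop :=
  h x \is a fin_num /\ forall y, (h x + (inner s (y - x))%:E <= h y)%E.

Lemma subgrad_monotone h x y s t :
  subgrad h x s -> subgrad h y t -> 0 <= inner (s - t) (x - y).
Proof.
move=> [+ /(_ y) + ] [+ /(_ x)].
case: (h x) => [a| |] //; case: (h y) => [b| |] // _ + _.
rewrite -!EFinD !lee_fin -(opprB x y) !innerE; lra.
Qed.

(** A real-valued perturbation [F] of a convex function contributes to the
    optimality condition only through its slope at the minimizer. *)
Lemma convex_first_order h (F : 'rV[R]_d -> R) x s :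
  ccp h -> h x \is a fin_num ->
  (forall y, exists b, forall t, 0 < t < 1 ->
     F (t *: y + (1 - t) *: x) <= F x + t * inner s (y - x) + t ^+ 2 * b) ->
  (forall y, (h x + (F x)%:E <= h y + (F y)%:E)%E) ->
  subgrad h x (- s).
Proof.
move=> [cvx _ [hNy _]] fx Fs hmin; split=> // y.
have [b Fb] := Fs y; have := hNy y; case hy: (h y) => [c| |] // _; last first.
  by rewrite leey.
move: fx; case hx: (h x) => [a| |] // _.
rewrite -EFinD lee_fin -subr_le0.
apply: (@le0_of_quadratic _ _ b) => t t01.
have := le_trans (hmin _) (leeD2r _ (cvx y x t t01)).
rewrite hx hy -!EFinM -!EFinD lee_fin.
have := Fb t t01; rewrite innerNl; lra.
Qed.

Lemma sqdist_continuous v : continuous (fun x => 2^-1 * norm2 (x - v) ^+ 2).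
Proof.
move=> x; have -> : (fun x => 2^-1 * norm2 (x - v) ^+ 2) =
    (fun x => 2^-1 * \sum_(j < d) (x 0 j - v 0 j) * (x 0 j - v 0 j)).
  apply/funext => y; rewrite norm2_sqr /inner big_ord1; congr (_ * _).
  by apply: eq_bigr => j _; rewrite !mxE.
have nbhs_x : Filter (nbhs x) by exact: nbhs_filter.
apply: (@cvgM _ _ (nbhs x)); first exact: cvg_cst.
apply: cvg_big => [|j _]; first exact: add_continuous.
by apply: cvgM; apply: cvgB; [exact: coord_continuous|exact: cvg_cst|
  exact: coord_continuous|exact: cvg_cst].
Qed.

(** The minimizer on a large ball is a global one: outside the ball the
    quadratic term dominates, because by convexity [h] decreases at most linearly
    along the rays from a point of its domain, at a rate bounded by its minimum
    over the unit ball around that point. *)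
Lemma prox_nonempty h v : ccp h ->
  argmin (fun x => h x + (2^-1 * norm2 (x - v) ^+ 2)%:E)%E !=set0.
Proof.
move=> [cvx /closed_fun_lsc lsc [hNy [x1 hx1]]].
have [a1 ha1] : exists a1, h x1 = a1%:E.
  by move: hx1 (hNy x1); case: (h x1) => [b| |] //; exists b.
have ball_x1 (e : R) : 0 <= e -> closed_ball_ Num.norm x1 e x1.
  by rewrite /closed_ball_ /= subrr normr0.
have [u0 _ min_u0] := lsc_compact_min lsc (@closed_ball_compact _ _ x1 1)
  (ex_intro _ x1 (ball_x1 1 ler01)).
have [m0 hm0] : exists m0, h u0 = m0%:E.
  have := min_u0 x1 (ball_x1 1 ler01); have := hNy u0; rewrite ha1.
  by case: (h u0) => [b| |] //; exists b.
have m0a1 : m0 <= a1.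
  by have := min_u0 x1 (ball_x1 1 ler01); rewrite ha1 hm0 lee_fin.
pose D := norm2 (x1 - v).
have D0 : 0 <= D := norm2_ge0 _.
(* Beyond [rho], [N ^+ 2 / 2] exceeds the loss [D * N] in the square plus the loss
   [(a1 - m0) * N] in [h], where [N] is the distance to [x1]; the summand 1
   keeps the ball larger than the unit ball. *)
pose rho := 1 + 2 * (D + (a1 - m0)).
have rho0 : 0 <= rho by rewrite /rho; lra.
have [p Kp minp] := lsc_compact_min (lscD_continuous lsc (@sqdist_continuous v))
  (@closed_ball_compact _ _ x1 rho) (ex_intro _ x1 (ball_x1 rho rho0)).
have px1 := minp x1 (ball_x1 rho rho0).
exists p; split=> [|y].
  by apply: le_lt_trans px1 _; rewrite ha1 ltry.
have [yK|yK] := leP `|x1 - y| rho; first exact: minp.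
apply: le_trans px1 _.
pose N := norm2 (y - x1).
have rhoN : rho < N.
  by apply: lt_le_trans yK _; rewrite distrC; exact: norm_le_norm2.
have N1 : 1 < N by apply: le_lt_trans rhoN; rewrite /rho; lra.
have N0 : 0 < N by lra.
have := hNy y; case hy: (h y) => [c| |] // _; last by rewrite addye // leey.
(* Convexity on the segment from [x1] to [y], at its point on the unit sphere. *)
have hc : N * m0 <= c + (N - 1) * a1.
  have NV01 : 0 < N^-1 < 1 by rewrite invr_gt0 N0 invf_lt1.
  have := cvx y x1 N^-1 NV01; rewrite hy ha1.
  have /min_u0 : closed_ball_ Num.norm x1 1 (N^-1 *: y + (1 - N^-1) *: x1).
    rewrite /closed_ball_ /= distrC; apply: le_trans (norm_le_norm2 _) _.
    have -> : N^-1 *: y + (1 - N^-1) *: x1 - x1 = N^-1 *: (y - x1).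
      by apply/matrixP => i j; rewrite !mxE; ring.
    by rewrite norm2Z -/N ger0_norm ?invr_ge0 ?(ltW N0) // mulVf // gt_eqF.
  rewrite hm0 => /le_trans h1 /h1; rewrite -!EFinM -EFinD lee_fin => {h1}.
  by rewrite -(ler_pM2l N0) mulrDr !mulrA mulrBr mulfV ?gt_eqF // mul1r mulr1.
rewrite ha1 -!EFinD lee_fin.
have -> : y - v = (y - x1) + (x1 - v) by rewrite addrA subrK.
have cs : - inner (y - x1) (x1 - v) <= N * D.
  by rewrite -innerNl opprB /N norm2B cauchy_schwarz.
rewrite [X in _ <= c + 2^-1 * X]norm2_sqr (innerDl (y - x1)).
rewrite !(innerDr (y - x1)) -!norm2_sqr.
rewrite (innerC (x1 - v)) -/N -/D.
move: (inner _ _) cs => w cs.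
have : 0 <= N * (N - rho) by rewrite mulr_ge0 //; lra.
rewrite /rho; nra.
Qed.

(** Minimality of the proximal point [p], to first order: the slope of the
    quadratic at [p] is [p - v]. *)
Lemma prox_subgrad h v : ccp h -> subgrad h (prox h v) (v - prox h v).
Proof.
move=> hccp; have /getPex := prox_nonempty v hccp; rewrite -/(prox h v).
move: (prox h v) => p [finp minp].
rewrite -opprB.
apply: (@convex_first_order _ (fun x => 2^-1 * norm2 (x - v) ^+ 2)) => //.
  case: hccp => _ _ [hNy _]; move: finp (hNy p).
  by case: (h p) => [b| |].
move=> y; exists (2^-1 * norm2 (y - p) ^+ 2) => t _.
have -> : t *: y + (1 - t) *: p - v = (p - v) + t *: (y - p).
  by apply/matrixP => i j; rewrite !mxE; ring.
rewrite !norm2_sqr !innerE (innerC p y) (innerC p v) (innerC y v); lra.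
Qed.

(** The subgradient inequality gains the quadratic [norm2 (y - p) ^+ 2 / 2], which
    makes the minimizer unique. *)
Lemma subgrad_prox h v p : subgrad h p (v - p) -> prox h v = p.
Proof.
move=> [finp hp].
have gain y : (h p + (2^-1 * norm2 (p - v) ^+ 2)%:E
    + (2^-1 * norm2 (y - p) ^+ 2)%:E <= h y + (2^-1 * norm2 (y - v) ^+ 2)%:E)%E.
  have := hp y; move: finp; case: (h p) => [a| |] // _.
  case: (h y) => [c| |]; [|by move=> _; rewrite addye // leey|by rewrite leeNy_eq].
  rewrite -!EFinD !lee_fin !norm2_sqr !innerE.
  rewrite (innerC p v) (innerC y v) (innerC y p); lra.
have argp : argmin (fun x => h x + (2^-1 * norm2 (x - v) ^+ 2)%:E)%E p.
  split; first by move: finp; case: (h p) => [a| |] // _; rewrite -EFinD ltry.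
  move=> y; apply: le_trans (gain y).
  by rewrite leeDl // lee_fin mulr_ge0 ?sqr_ge0 // invr_ge0.
have [_ /(_ p)] :
    argmin (fun x => h x + (2^-1 * norm2 (x - v) ^+ 2)%:E)%E (prox h v).
  by apply: getPex; exists p.
move=> /(le_trans (gain _)); move: finp; case: (h p) => [a| |] // _.
rewrite -!EFinD lee_fin gerDl pmulr_rle0 ?invr_gt0 // => le0.
apply/eqP; rewrite -subr_eq0; apply/eqP/norm2_eq0/eqP.
by rewrite -sqrf_eq0 eq_le le0 sqr_ge0.
Qed.

Lemma leeZ_inv (a s : R) (e : \bar R) : 0 < a ->
  (a%:E * e <= s%:E)%E = (e <= (a^-1 * s)%:E)%E.
Proof.
move=> a0; case: e => [b| |].
- by rewrite -EFinM !lee_fin [RHS]ler_pdivlMl.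
- by rewrite gt0_muley ?lte_fin // !leye_eq.
- by rewrite gt0_muleNy ?lte_fin // !leNye.
Qed.

Lemma ccpZ h (a : R) : 0 < a -> ccp h -> ccp (fun x => a%:E * h x)%E.
Proof.
move=> a0 [cvx clh [hNy [x0 hx0]]].
split; last split.
- move=> x y t t01; have [t0 t1] := andP t01.
  have t1' : 0 < 1 - t by rewrite subr_gt0.
  have := cvx x y t t01; have := hNy x; have := hNy y.
  case: (h x) => [b| |] // + _; case: (h y) => [c| |] // _;
    rewrite ?gt0_muley ?lte_fin // ?gt0_muley ?lte_fin //;
    rewrite ?addey ?addye ?leey // => hc.
  rewrite leeZ_inv // (le_trans hc) // -!EFinM -!EFinD lee_fin.
  by rewrite mulrCA [_ * (a * c)]mulrCA -mulrDr mulKf ?gt_eqF.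
- rewrite /closed_fun.
  have -> : [set q : 'rV[R]_d * R | (a%:E * h q.1 <= q.2%:E)%E] =
      (fun q : 'rV[R]_d * R => (q.1, a^-1 * q.2)) @^-1`
      [set q : 'rV[R]_d * R | (h q.1 <= q.2%:E)%E].
    by apply/funext => -[x s] /=; rewrite leeZ_inv.
  apply: preimage_closed clh => q _.
  have nbhs_q : Filter (nbhs q) by exact: nbhs_filter.
  have fst_q : (fun u : 'rV[R]_d * R => u.1) @ nbhs q --> nbhs q.1.
    exact: cvg_fst.
  have snd_q : (fun u : 'rV[R]_d * R => a^-1 * u.2) @ nbhs q
      --> nbhs (a^-1 * q.2).
    by apply: (@cvgM _ _ (nbhs q)); [exact: cvg_cst|exact: cvg_snd].
  exact: (cvg_pair fst_q snd_q).
- move=> x; move: (hNy x); case: (h x) => [b| |] //= _.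
  by rewrite gt0_muley.
- exists x0; move: hx0 (hNy x0); case: (h x0) => [b| |] // _ _.
  by rewrite -EFinM ltry.
Qed.

Lemma subgradZ h (a : R) x s : 0 < a ->
  subgrad (fun x => a%:E * h x)%E x s <-> subgrad h x (a^-1 *: s).
Proof.
move=> a0.
have scaled b w (e : \bar R) :
    (a%:E * b%:E + w%:E <= a%:E * e)%E = (b%:E + (a^-1 * w)%:E <= e)%E.
  case: e => [c| |]; rewrite ?gt0_muley ?gt0_muleNy ?lte_fin // ?leey //.
  rewrite -!EFinM -!EFinD !lee_fin -[RHS](ler_pM2l a0).
  by rewrite mulrDr mulVKf // gt_eqF.
rewrite /subgrad; case hx: (h x) => [b| |]; first last.
- by rewrite gt0_muleNy ?lte_fin //; split=> -[].
- by rewrite gt0_muley ?lte_fin //; split=> -[].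
by split=> -[_ hs]; split=> // y; have := hs y; rewrite innerZl scaled.
Qed.

End Subgradient.

(** * Smooth convex functions *)

Section Gradient.
Context {R : realType} {d : nat}.
Implicit Types (F : 'rV[R]_d -> R) (x v : 'rV[R]_d).

Lemma derive_gradient F x v :
  differentiable F x -> 'D_v F x = inner (gradient F x) v.
Proof.
move=> dF; rewrite deriveE // {1}(row_sum_delta v) linear_sum /inner big_ord1.
by apply: eq_bigr => j _; rewrite linearZ /= mxE deriveE // mulrC.
Qed.

Lemma is_derive_line F x v t : differentiable F (x + t *: v) ->
  is_derive t 1 (fun s => F (x + s *: v)) (inner (gradient F (x + t *: v)) v).
Proof.
move=> dF.
have quot : (fun h : R => h^-1 *: (((fun s => F (x + s *: v)) \o shift t) (h *: 1) -
      F (x + t *: v))) =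
    (fun h : R => h^-1 *: ((F \o shift (x + t *: v)) (h *: v) - F (x + t *: v))).
  apply/funext => h /=; congr (_ *: (F _ - _)).
  by rewrite [h%:A]mulr1 scalerDl addrCA.
apply: DeriveDef.
  by rewrite /derivable quot; exact: diff_derivable.
by rewrite -derive_gradient // /derive quot.
Qed.

(** The slope along the segment grows at rate at most [L * norm2 v ^+ 2]; the mean
    value theorem, applied after subtracting the quadratic, integrates this. *)
Lemma descent_lemma F (L : R) x v :
  (forall y, differentiable F y) ->
  (forall y z, norm2 (gradient F y - gradient F z) <= L * norm2 (y - z)) ->
  F (x + v) <= F x + inner (gradient F x) v + L / 2 * norm2 v ^+ 2.
Proof.
move=> dF lipF.
pose a := inner (gradient F x) v.
pose b := L / 2 * norm2 v ^+ 2.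
pose phi := fun t : R => F (x + t *: v) - (t * a + t ^+ 2 * b).
have dphi (t : R) : is_derive t 1 phi
    (inner (gradient F (x + t *: v)) v - (a + 2 * t * b)).
  have dl := is_derive_line (dF (x + t *: v)).
  have dq : is_derive t 1 (fun s : R => s * a + s ^+ 2 * b) (a + 2 * t * b).
    by apply: is_derive_eq; rewrite !scaler0 !add0r /GRing.scale /=; ring.
  exact: is_deriveB.
have cphi : {within `[0, 1], continuous phi}.
  by apply: derivable_within_continuous => t _; apply: ex_derive.
have [c c01] := MVT_segment ler01 (fun t _ => dphi t) cphi.
have {c01} c0 : 0 <= c by move: c01; rewrite in_itv /= => /andP[].
rewrite /phi subr0 mulr1 scale1r scale0r addr0 => hc.
have : inner (gradient F (x + c *: v) - gradient F x) v <= 2 * c * b.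
  apply: le_trans (cauchy_schwarz _ _) _.
  apply: le_trans (_ : L * norm2 (x + c *: v - x) * norm2 v <= _).
    by rewrite ler_wpM2r ?norm2_ge0.
  rewrite addrAC subrr add0r norm2Z ger0_norm // /b; lra.
rewrite innerBl -/a; move: hc; rewrite -/b; lra.
Qed.

(** Chords of a convex function are steeper than its derivative at their start. *)
Lemma convex_gradient (f : 'rV[R]_d -> \bar R) x :
  convex_fun f -> differentiable_fun f -> subgrad f x (grad f x).
Proof.
move=> cvx df; split=> [|y]; first by have [] := df x.
have [fx dfx] := df x; have [fy _] := df y.
rewrite -(fineK fx) -(fineK fy) -EFinD lee_fin -lerBrDl -derive_gradient //.
have /cvg_dnbhs_at_right q : (fun h : R => h^-1 *:
    (((fine \o f) \o shift x) (h *: (y - x)) - (fine \o f) x)) @ 0^' -->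
    'D_(y - x) (fine \o f) x.
  exact: diff_derivable.
apply: (cvgr_to_le q); near=> t.
have t01 : 0 < t < 1.
  by apply/andP; split; near: t; [exact: nbhs_right_gt|exact: nbhs_right_lt].
have := cvx y x t t01.
have -> : t *: y + (1 - t) *: x = t *: (y - x) + x.
  by apply/matrixP => i j; rewrite !mxE; ring.
have [ft _] := df (t *: (y - x) + x).
rewrite -(fineK ft) -(fineK fx) -(fineK fy) -!EFinM -EFinD lee_fin => ht.
have /andP[t0 _] := t01; rewrite ler_pdivrMl //=; lra.
Unshelve. all: by end_near. Qed.

(** Baillon-Haddad: compare the lower bound from the tangent at [x] with the
    upper bound of the descent lemma at [y], both at the point reached from [y] by
    the step [L^-1 *: (grad f x - grad f y)], which minimizes their difference;
    then exchange [x] and [y]. *)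
Lemma gradient_cocoercive (f : 'rV[R]_d -> \bar R) (L : R) x y : 0 < L ->
  convex_fun f -> differentiable_fun f -> lipschitz_grad L f ->
  L^-1 * norm2 (grad f x - grad f y) ^+ 2 <= inner (grad f x - grad f y) (x - y).
Proof.
move=> L0 cvx df lip.
have bound u v : fine (f u) + inner (grad f u) (v - u) +
    (2 * L)^-1 * norm2 (grad f u - grad f v) ^+ 2 <= fine (f v).
  pose D := grad f u - grad f v.
  have low : fine (f u) + inner (grad f u) (v - u + L^-1 *: D)
      <= fine (f (v + L^-1 *: D)).
    have [_ /(_ (v + L^-1 *: D))] := convex_gradient u cvx df.
    have [fu _] := df u; have [fw _] := df (v + L^-1 *: D).
    by rewrite -(fineK fu) -(fineK fw) -EFinD lee_fin addrAC.
  have /(le_trans low) := @descent_lemma (fine \o f) L v (L^-1 *: D)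
    (fun z => (df z).2) lip.
  rewrite /= -/(grad f v) norm2Z exprMn ger0_norm ?invr_ge0 ?(ltW L0) //.
  rewrite innerDr !innerZr -/D norm2_sqr.
  have -> : L / 2 * (L^-1 ^+ 2 * inner D D) = L^-1 * (2^-1 * inner D D).
    by field; rewrite gt_eqF.
  have -> : inner D D = inner (grad f u) D - inner (grad f v) D.
    by rewrite -innerBl.
  rewrite invfM; lra.
have := bound x y; have := bound y x.
rewrite (norm2B (grad f y)) invfM -(opprB x y) innerNr innerBl.
move: (norm2 _ ^+ 2) => N; lra.
Qed.

End Gradient.

(** * Iterating averaged operators *)

(** The squared residuals of an averaged operator are summable along its
    iterates and nonincreasing, hence of order [1 / k]; they vanish at any
    cluster point of the iterates, and the distance to such a fixed point
    decreases, so the whole sequence converges to it. *)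
Section Averaged.
Context {R : realType} {m d : nat}.
Variables (T : 'M[R]_(m, d) -> 'M[R]_(m, d)) (c : R).
Hypothesis c_gt0 : 0 < c.
Hypothesis averaged : forall z w, norm2 (T z - T w) ^+ 2 <=
  norm2 (z - w) ^+ 2 - c * norm2 ((z - T z) - (w - T w)) ^+ 2.
Variable z : nat -> 'M[R]_(m, d).
Hypothesis z_iter : forall k, z k.+1 = T (z k).

Lemma averaged_nonexpansive u w : norm2 (T u - T w) <= norm2 (u - w).
Proof.
rewrite -(@ler_pXn2r _ 2) ?nnegrE ?norm2_ge0 //.
apply: le_trans (averaged u w) _.
by rewrite gerBl mulr_ge0 ?sqr_ge0 // ltW.
Qed.

Lemma residual_nonincreasing j k : (j <= k)%N ->
  norm2 (z k - T (z k)) <= norm2 (z j - T (z j)).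
Proof.
elim: k => [|k IH]; first by rewrite leqn0 => /eqP ->.
rewrite leq_eqVlt => /predU1P[-> //|]; rewrite ltnS => /IH; apply: le_trans.
by rewrite z_iter averaged_nonexpansive.
Qed.

Variable w0 : 'M[R]_(m, d).
Hypothesis w0_fixed : T w0 = w0.

Lemma residual_summable k :
  c * (k%:R * norm2 (z k - T (z k)) ^+ 2) <= norm2 (z 0%N - w0) ^+ 2.
Proof.
suff : norm2 (z k - w0) ^+ 2 + c * (k%:R * norm2 (z k - T (z k)) ^+ 2)
    <= norm2 (z 0%N - w0) ^+ 2.
  by apply: le_trans; rewrite lerDr sqr_ge0.
elim: k => [|k IH]; first by rewrite mul0r mulr0 addr0.
have step := averaged (z k) w0; rewrite w0_fixed subrr subr0 -z_iter in step.
have mono : norm2 (z k.+1 - T (z k.+1)) ^+ 2 <= norm2 (z k - T (z k)) ^+ 2.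
  by rewrite ler_pXn2r ?nnegrE ?norm2_ge0 // residual_nonincreasing.
rewrite -natr1 mulrDl mul1r.
have : c * ((k%:R + 1) * norm2 (z k.+1 - T (z k.+1)) ^+ 2) <=
    c * ((k%:R + 1) * norm2 (z k - T (z k)) ^+ 2).
  by rewrite ler_pM2l // ler_wpM2l // addr_ge0.
rewrite -!z_iter in IH step mono *; lra.
Qed.

Lemma residual_vanishes (e : R) : 0 < e ->
  exists N, forall k, (N <= k)%N -> norm2 (z k - T (z k)) < e.
Proof.
move=> e0; pose D := norm2 (z 0%N - w0) ^+ 2 / (c * e ^+ 2).
have ce : 0 < c * e ^+ 2 by rewrite mulr_gt0 // exprn_gt0.
exists (Num.truncn D).+1 => k Nk; rewrite ltNge; apply/negP => le_e.
have Dk : D < k%:R.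
  apply: lt_le_trans (_ : (Num.truncn D).+1%:R <= _); last by rewrite ler_nat.
  exact: truncnS_gt.
have := residual_summable k; apply/negP; rewrite -ltNge.
rewrite ltr_pdivrMr // in Dk; apply: lt_le_trans Dk _.
rewrite mulrCA ler_pM2l // ler_wpM2l //.
by rewrite ler_pXn2r ?nnegrE ?norm2_ge0 // ltW.
Qed.

Lemma scaled_residual_rate (q : nat -> R) (a : R) : 0 < a ->
  (forall k, q k = a * norm2 (z k - T (z k))) ->
  [/\ forall k, q k.+1 <= q k, q @ \oo --> (0 : R) &
      q =O_\oo (fun k => (Num.sqrt k%:R)^-1 : R)].
Proof.
move=> a0 qE; have q_ge0 k : 0 <= q k by rewrite qE mulr_ge0 ?norm2_ge0 // ltW.
split=> [k||].
- by rewrite !qE ler_pM2l // residual_nonincreasing.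
- apply/cvgrPdist_lt => e e0.
  have [N resN] := residual_vanishes (divr_gt0 e0 a0).
  near=> k; rewrite sub0r normrN ger0_norm // qE mulrC -ltr_pdivlMr //.
  by apply: resN; near: k; exists N.
- pose D := norm2 (z 0%N - w0).
  have C_ge0 : 0 <= a * (D / Num.sqrt c).
    by rewrite mulr_ge0 ?divr_ge0 ?sqrtr_ge0 ?norm2_ge0 // ltW.
  apply/eqO_exP; exists (a * (D / Num.sqrt c) + 1); first by rewrite ltr_wpDl.
  near=> k.
  have k_gt0 : 0 < (k%:R : R) by rewrite ltr0n; near: k; exists 1%N.
  rewrite !ger0_norm ?invr_ge0 ?sqrtr_ge0 // qE.
  apply: le_trans (_ : a * (D / Num.sqrt c) * (Num.sqrt k%:R)^-1 <= _).
    rewrite -mulrA ler_pM2l // -mulrA -invfM -sqrtrM ?(ltW c_gt0) //.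
    have ck : 0 < Num.sqrt (c * k%:R) by rewrite sqrtr_gt0 mulr_gt0.
    rewrite ler_pdivlMr //.
    rewrite -(@ler_pXn2r _ 2) ?nnegrE ?mulr_ge0 ?norm2_ge0 ?(ltW ck) //.
    rewrite exprMn (@sqr_sqrtr _ (c * _)) ?(ltW (mulr_gt0 c_gt0 k_gt0)) //.
    rewrite mulrC -mulrA.
    exact: residual_summable.
  by rewrite ler_wpM2r ?invr_ge0 ?sqrtr_ge0 // lerDl.
Unshelve. all: by end_near. Qed.

Lemma dist_fixed_nonincreasing w j k : T w = w -> (j <= k)%N ->
  norm2 (z k - w) <= norm2 (z j - w).
Proof.
move=> fw; elim: k => [|k IH]; first by rewrite leqn0 => /eqP ->.
rewrite leq_eqVlt => /predU1P[-> //|]; rewrite ltnS => /IH; apply: le_trans.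
by rewrite z_iter -{1}fw averaged_nonexpansive.
Qed.

Lemma averaged_converges :
  exists2 w, T w = w & forall e, 0 < e ->
    exists N, forall k, (N <= k)%N -> norm2 (z k - w) < e.
Proof.
have [|w clw] := @norm2_bounded_cluster _ _ _ z (norm2 (z 0%N - w0) + norm2 w0).
  move=> k; rewrite -{1}[z k](subrK w0) (le_trans (norm2D _ _)) // lerD2r.
  exact: dist_fixed_nonincreasing.
have fw : T w = w.
  apply/eqP; rewrite -subr_eq0; apply/eqP/norm2_eq0/eqP.
  rewrite eq_le norm2_ge0 andbT leNgt; apply/negP => e0.
  have e30 : 0 < norm2 (T w - w) / 3 by rewrite divr_gt0.
  have [N resN] := residual_vanishes e30.
  have [k Nk near_w] := clw _ e30 N.
  have : norm2 (T w - w) <= norm2 (T w - T (z k)) + norm2 (T (z k) - z k) +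
      norm2 (z k - w).
    have -> : T w - w = (T w - T (z k)) + (T (z k) - z k) + (z k - w).
      by rewrite !addrA !subrK.
    by rewrite (le_trans (norm2D _ _)) // lerD2r norm2D.
  have := averaged_nonexpansive w (z k); have := resN k Nk.
  rewrite (norm2B (T (z k))) (norm2B w); lra.
exists w => // e e0; have [N _ near_w] := clw e e0 0%N.
by exists N => k Nk; apply: le_lt_trans near_w; exact: dist_fixed_nonincreasing.
Qed.

End Averaged.

(** * One iteration of the method *)

(** Here [dz] is the difference of two inputs, [dx] and [du] those of
    the two proximal points, and [dc] that of the scaled gradients. In the
    expansion of the left-hand side the two monotonicity inequalities leave, besides
    [|dz|^2 - |du - dx|^2], only cross terms with [dc]; cocoercivity and Young's
    inequality absorb them at the cost of [K / 2 * |du - dx|^2]. *)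
Lemma three_operator_contraction {R : realType} m d
    (dz dx du dc : 'M[R]_(m, d)) (K : R) : 0 < K ->
  0 <= inner (dz - dx) dx ->
  0 <= inner (2 *: dx - dz - dc - du) du ->
  K^-1 * inner dc dc <= inner dc dx ->
  norm2 (dz + du - dx) ^+ 2 <=
    norm2 dz ^+ 2 - (1 - K / 2) * norm2 (du - dx) ^+ 2.
Proof.
move=> K0 mono_x mono_u coco.
have young : 0 <= 2 * (K^-1 * inner dc dc) + 2 * inner dc (du - dx)
    + K / 2 * inner (du - dx) (du - dx).
  have -> : 2 * (K^-1 * inner dc dc) + 2 * inner dc (du - dx)
      + K / 2 * inner (du - dx) (du - dx) =
      K / 2 * inner (2 / K *: dc + (du - dx)) (2 / K *: dc + (du - dx)).
    move: (du - dx) => e; rewrite !innerE (innerC e dc).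
    by field; rewrite gt_eqF.
  by rewrite mulr_ge0 ?inner_ge0 // divr_ge0 // ltW.
rewrite !norm2_sqr.
move: mono_x mono_u coco young; rewrite !innerE.
rewrite (innerC dx dz) (innerC du dz) (innerC dx du).
lra.
Qed.

Section Consensus.
Context {R : realType} {n d : nat}.
Implicit Types (A B : 'M[R]_(n, d)) (x u : 'rV[R]_d).

Definition consensus x : 'M[R]_(n, d) := \matrix_(i < n) x.

Lemma row_consensus x i : row i (consensus x) = x.
Proof. exact: rowK. Qed.

Lemma rowB A B i : row i (A - B) = row i A - row i B.
Proof. by apply/rowP => j; rewrite !mxE. Qed.

Lemma consensusB x u : consensus (x - u) = consensus x - consensus u.
Proof. by apply/matrixP => i j; rewrite !mxE. Qed.

Lemma inner_rows A B : inner A B = \sum_(i < n) inner (row i A) (row i B).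
Proof.
apply: eq_bigr => i _; rewrite /inner big_ord1.
by apply: eq_bigr => j _; rewrite !mxE.
Qed.

Lemma norm2_row_le A i : norm2 (row i A) <= norm2 A.
Proof.
rewrite -(@ler_pXn2r _ 2) ?nnegrE ?norm2_ge0 // !norm2_sqr inner_rows.
by rewrite (bigD1 i) //= lerDl sumr_ge0 // => j _; exact: inner_ge0.
Qed.

Lemma meanD A B : mean (A + B) = mean A + mean B.
Proof.
rewrite /mean -scalerDr -big_split; congr (_ *: _).
by apply: eq_bigr => i _; apply/rowP => j; rewrite !mxE.
Qed.

Lemma meanZ (a : R) A : mean (a *: A) = a *: mean A.
Proof.
rewrite /mean scalerA mulrC -scalerA; congr (_ *: _); rewrite scaler_sumr.
by apply: eq_bigr => i _; rewrite linearZ.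
Qed.

Lemma meanB A B : mean (A - B) = mean A - mean B.
Proof. by rewrite meanD -scaleN1r meanZ scaleN1r. Qed.

Lemma mean_consensus x : (0 < n)%N -> mean (consensus x) = x.
Proof.
move=> n0; rewrite /mean (eq_bigr (fun=> x)) => [|i _]; last first.
  exact: row_consensus.
rewrite sumr_const card_ord -[x *+ n]scaler_nat scalerA mulVf ?scale1r //.
by rewrite pnatr_eq0 -lt0n.
Qed.

Lemma inner_suml (I : Type) (s : seq I) (F : I -> 'rV[R]_d) u :
  inner (\sum_(i <- s) F i) u = \sum_(i <- s) inner (F i) u.
Proof.
elim: s => [|i s IH]; first by rewrite !big_nil innerC inner0r.
by rewrite !big_cons innerDl IH.
Qed.

Lemma inner_consensus A u :
  (0 < n)%N -> inner A (consensus u) = n%:R * inner (mean A) u.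
Proof.
move=> n0; rewrite innerZl mulVKf ?pnatr_eq0 -?lt0n // inner_suml inner_rows.
by apply: eq_bigr => i _; rewrite row_consensus.
Qed.

Lemma norm2_consensus_ge x : (0 < n)%N -> norm2 x <= norm2 (consensus x).
Proof.
move=> n0; rewrite -(@ler_pXn2r _ 2) ?nnegrE ?norm2_ge0 // !norm2_sqr.
rewrite inner_consensus // mean_consensus //.
by rewrite ler_peMl ?inner_ge0 // ler1n.
Qed.

End Consensus.

(** The iteration for abstract maps: [P] and [Q i] stand for the proximal maps of
    [r] and [g i], and [G i] for a gradient step of [f i], so that the argument
    rests on firm nonexpansiveness and cocoercivity alone. *)
Section Splitting.
Context {R : realType} {d n : nat}.
Hypothesis n_gt0 : (0 < n)%N.
Variables (P : 'rV[R]_d -> 'rV[R]_d) (Q G : 'I_n -> 'rV[R]_d -> 'rV[R]_d).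
Variable K : R.
Hypothesis K_gt0 : 0 < K.

Definition firmly_nonexpansive (S : 'rV[R]_d -> 'rV[R]_d) : Prop :=
  forall u v, 0 <= inner ((u - S u) - (v - S v)) (S u - S v).

Hypothesis P_firm : firmly_nonexpansive P.
Hypothesis Q_firm : forall i, firmly_nonexpansive (Q i).
Hypothesis G_cocoercive : forall i u v,
  K^-1 * norm2 (G i u - G i v) ^+ 2 <= inner (G i u - G i v) (u - v).

Definition split_half (z : 'M[R]_(n, d)) : 'rV[R]_d := P (mean z).

Definition split_residual (z : 'M[R]_(n, d)) : 'M[R]_(n, d) :=
  \matrix_(i < n) (split_half z -
    Q i (2 *: split_half z - row i z - G i (split_half z))).

Definition split_next (z : 'M[R]_(n, d)) : 'M[R]_(n, d) :=
  z - split_residual z.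

Lemma row_split_residual z i : row i (split_residual z) =
  split_half z - Q i (2 *: split_half z - row i z - G i (split_half z)).
Proof. exact: rowK. Qed.

(** Firm nonexpansiveness of [P], lifted to tuples: averaging followed by [P] is
    the resolvent of the lifted operator. *)
Lemma split_half_monotone z w :
  0 <= inner ((z - w) - consensus (split_half z - split_half w))
             (consensus (split_half z - split_half w)).
Proof.
rewrite inner_consensus // meanB mean_consensus // meanB mulr_ge0 //.
have := P_firm (mean z) (mean w); congr (0 <= inner _ _).
rewrite -/(split_half z) -/(split_half w).
move: (split_half z) (split_half w) (mean z) (mean w) => x y a b.
by apply/rowP => j; rewrite !mxE; ring.
Qed.

Lemma split_half_nonexpansive z w :
  norm2 (split_half z - split_half w) <= norm2 (z - w).
Proof.
apply: le_trans (norm2_consensus_ge _ n_gt0) _.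
have := split_half_monotone z w; rewrite innerBl.
move: (consensus _) => dx; rewrite subr_ge0 -norm2_sqr => h.
have := le_trans h (cauchy_schwarz _ _).
have [->|dx0] := eqVneq (norm2 dx) 0; first by rewrite norm2_ge0.
by rewrite expr2 ler_pM2r // lt_neqAle eq_sym dx0 norm2_ge0.
Qed.

Lemma split_next_averaged z w :
  norm2 (split_next z - split_next w) ^+ 2 <= norm2 (z - w) ^+ 2 -
    (1 - K / 2) * norm2 ((z - split_next z) - (w - split_next w)) ^+ 2.
Proof.
have mono_x := split_half_monotone z w.
rewrite /split_next !subKr.
have res_z := row_split_residual z; have res_w := row_split_residual w.
move: (split_half z) (split_half w) (split_residual z) (split_residual w)
  mono_x res_z res_w => x y a b mono_x aE bE.
pose u i := Q i (2 *: x - row i z - G i x).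
pose v i := Q i (2 *: y - row i w - G i y).
pose dx : 'M[R]_(n, d) := consensus (x - y).
pose du : 'M[R]_(n, d) := \matrix_(i < n) (u i - v i).
pose dc : 'M[R]_(n, d) := \matrix_(i < n) (G i x - G i y).
have res : a - b = dx - du.
  apply/row_matrixP => i; rewrite [LHS]rowB [RHS]rowB aE bE.
  rewrite row_consensus rowK -/(u i) -/(v i).
  by apply/rowP => k; rewrite !mxE; ring.
have -> : z - a - (w - b) = z - w - (a - b).
  by apply/matrixP => i j; rewrite !mxE; ring.
rewrite res (norm2B dx) (opprB dx).
have -> : z - w + (du - dx) = z - w + du - dx by rewrite addrA.
apply: (three_operator_contraction (dc := dc)) => //.
- rewrite inner_rows sumr_ge0 // => i _.
  have := Q_firm i (2 *: x - row i z - G i x) (2 *: y - row i w - G i y).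
  rewrite -/(u i) -/(v i) rowK; congr (0 <= inner _ _).
  by apply/rowP => k; rewrite !mxE; ring.
- rewrite !inner_rows mulr_sumr; apply: ler_sum => i _.
  by rewrite row_consensus rowK -norm2_sqr.
Qed.

End Splitting.

(** * Optimality and fixed points *)

Section SubgradientCalculus.
Context {R : realType} {d : nat}.
Implicit Types (h : 'rV[R]_d -> \bar R) (x s : 'rV[R]_d).

Lemma subgradD h1 h2 x s1 s2 : subgrad h1 x s1 -> subgrad h2 x s2 ->
  subgrad (fun y => h1 y + h2 y)%E x (s1 + s2).
Proof.
move=> [fx1 hs1] [fx2 hs2]; split=> [|y]; first by rewrite fin_numD fx1.
rewrite innerDl EFinD addeACA; exact: leeD.
Qed.

Lemma subgrad_sum (n : nat) (h : 'I_n -> 'rV[R]_d -> \bar R) x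
    (s : 'I_n -> 'rV[R]_d) :
  (forall i, subgrad (h i) x (s i)) ->
  subgrad (fun y => \sum_(i < n) h i y)%E x (\sum_(i < n) s i).
Proof.
move=> hs; elim: (index_enum _) => [|i l IH].
  rewrite big_nil; split=> [|y]; first by rewrite big_nil.
  by rewrite !big_nil innerC inner0r adde0.
rewrite big_cons; have -> : (fun y => \sum_(j <- i :: l) h j y)%E =
    (fun y => h i y + \sum_(j <- l) h j y)%E.
  by apply/funext => y; rewrite big_cons.
exact: subgradD.
Qed.

Lemma subgrad0_argmin h x : subgrad h x 0 -> argmin h x.
Proof.
move=> [fx hx]; split; first by rewrite ltey_eq fx.
by move=> y; have := hx y; rewrite innerC inner0r adde0.
Qed.

End SubgradientCalculus.

(** The forward step on the smooth term, without the identity part. *)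
Definition gradient_step {R : realType} {d n : nat}
    (f : 'I_n -> 'rV[R]_d -> \bar R) (alpha : R) (i : 'I_n) (x : 'rV[R]_d) :
  'rV[R]_d := alpha *: grad (f i) x.

Section FixedPoints.
Context {R : realType} {d n : nat}.
Hypothesis n_gt0 : (0 < n)%N.
Variables (r : 'rV[R]_d -> \bar R) (f g : 'I_n -> 'rV[R]_d -> \bar R).
Variables (L alpha : R).
Hypotheses (r_ccp : ccp r) (f_ccp : forall i, ccp (f i)).
Hypothesis g_ccp : forall i, ccp (g i).
Hypotheses (L_gt0 : 0 < L) (f_diff : forall i, differentiable_fun (f i)).
Hypothesis f_lip : forall i, lipschitz_grad L (f i).
Hypothesis alpha_gt0 : 0 < alpha.

Let G := gradient_step f alpha.
Let half := split_half (n := n) (prox_r r alpha).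
Let residual := split_residual (prox_r r alpha) (prox_g g alpha) G.
Let next := split_next (prox_r r alpha) (prox_g g alpha) G.

Lemma prox_firmly_nonexpansive (h : 'rV[R]_d -> \bar R) :
  ccp h -> firmly_nonexpansive (prox (fun y => alpha%:E * h y)%E).
Proof.
move=> hccp u v; have hccp' := ccpZ alpha_gt0 hccp.
exact: subgrad_monotone (prox_subgrad u hccp') (prox_subgrad v hccp').
Qed.

Lemma step_cocoercive i u v :
  (alpha * L)^-1 * norm2 (G i u - G i v) ^+ 2 <= inner (G i u - G i v) (u - v).
Proof.
have [cvx _ _] := f_ccp i.
have := gradient_cocoercive u v L_gt0 cvx (f_diff i) (f_lip i).
rewrite /G /gradient_step -scalerBr !norm2_sqr !innerZl innerZr.
move: (grad _ _ - grad _ _) => c coco.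
have -> : (alpha * L)^-1 * (alpha * (alpha * inner c c)) =
    alpha * (L^-1 * inner c c).
  by field; rewrite !gt_eqF.
by rewrite ler_pM2l.
Qed.

Lemma scale_ppg_p z : alpha *: ppg_p r f g alpha z = residual z.
Proof.
by apply/row_matrixP => i; rewrite linearZ /= !rowK scalerA mulfV ?scale1r ?gt_eqF.
Qed.

Lemma ppg_generated_split z xh xs : ppg_generated r f g alpha z xh xs ->
  forall k, [/\ z k.+1 = next (z k), xh k = half (z k) &
    forall i, row i (xs k.+1) = xh k - row i (residual (z k))].
Proof.
move=> gen k; have [xhE rows] := gen k.
have xsE i : row i (xs k.+1) = xh k - row i (residual (z k)).
  by have [-> _] := rows i; rewrite row_split_residual xhE subKr.
split=> //; apply/row_matrixP => i; have [_ ->] := rows i.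
by rewrite xsE rowB addrAC addrA subrK.
Qed.

Lemma residual_eq0 w i : residual w = 0 ->
  prox_g g alpha i (2 *: half w - row i w - G i (half w)) = half w.
Proof.
move=> /(congr1 (row i)); rewrite row_split_residual row0 => /eqP.
by rewrite subr_eq0 eq_sym => /eqP.
Qed.

Lemma residual_eq0_fixed w : residual w = 0 -> ppg_fixed_point r f g alpha w.
Proof.
move=> w0; exists (half w), (consensus (half w)); split=> // i.
by rewrite row_consensus addrK (residual_eq0 i w0).
Qed.

(** At a fixed point the proximal steps give subgradients of [r] and of all
    [g i] at the same point, and together with the gradients they add up to
    zero. *)
Lemma residual_eq0_argmin w : residual w = 0 -> argmin (objective r f g) (half w).
Proof.
move=> w0; apply: subgrad0_argmin; set x := half w.
have sub_r : subgrad r x (alpha^-1 *: (mean w - x)).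
  by apply/subgradZ => //; exact: prox_subgrad (ccpZ alpha_gt0 r_ccp).
have sub_f i : subgrad (f i) x (grad (f i) x).
  by have [cvx _ _] := f_ccp i; exact: convex_gradient.
have sub_g i : subgrad (g i) x (alpha^-1 *: (x - row i w) - grad (f i) x).
  have := prox_subgrad (2 *: x - row i w - G i x) (ccpZ alpha_gt0 (g_ccp i)).
  rewrite -/(prox_g g alpha i _) (residual_eq0 i w0) => /subgradZ-/(_ alpha_gt0).
  congr subgrad; rewrite /G /gradient_step -/x.
  move: (grad _ _) (row i w) => gx wi.
  by apply/rowP => j; rewrite !mxE; field; rewrite gt_eqF.
have sub_sum := subgrad_sum (fun i => subgradD (sub_f i) (sub_g i)).
have nR_gt0 : 0 < (n%:R : R)^-1 by rewrite invr_gt0 ltr0n.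
have sub_mean : subgrad
    (fun y => (n%:R^-1)%:E * \sum_(i < n) (f i y + g i y))%E x
    (alpha^-1 *: (x - mean w)).
  apply/subgradZ => //; rewrite invrK.
  move: sub_sum; congr subgrad.
  rewrite (eq_bigr (fun i => alpha^-1 *: (x - row i w))) => [|i _]; last first.
    by rewrite addrC subrK.
  rewrite -scaler_sumr sumrB sumr_const card_ord [RHS]scalerA mulrC -scalerA.
  congr (_ *: _); rewrite scalerBr scaler_nat; congr (_ - _).
  by rewrite /mean scalerA mulfV ?scale1r // pnatr_eq0 -lt0n.
have := subgradD sub_r sub_mean; congr subgrad.
by rewrite -scalerDr addrA subrK subrr scaler0.
Qed.

Let cost i y := (f i y + g i y)%E.

Lemma lagrangianE x (xs nu : 'M[R]_(n, d)) : lagrangian r f g x xs nu =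
  (r x + (n%:R^-1)%:E * \sum_(i < n) cost i (row i xs)
   + (n%:R^-1 * inner nu (xs - consensus x))%:E)%E.
Proof.
congr (_ + (_ * _)%:E)%E; rewrite inner_rows; apply: eq_bigr => i _.
by rewrite rowB row_consensus /inner big_ord1.
Qed.

Let nV_gt0 : 0 < (n%:R : R)^-1.
Proof. by rewrite invr_gt0 ltr0n. Qed.

Lemma cost_gtNy i y : (cost i y != -oo)%E.
Proof.
have [fy _] := f_diff i y; have [_ _ [gNy _]] := g_ccp i; have := gNy y.
by rewrite /cost; move: fy; case: (f i y) => [a| |] // _; case: (g i y).
Qed.

(** A saddle value is finite because [r] and all [g i] are finite somewhere. *)
Lemma saddle_point_finite x xs nu : saddle_point r f g x xs nu ->
  r x \is a fin_num /\ forall i, cost i (row i xs) \is a fin_num.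
Proof.
move=> [minx _]; have [_ _ [rNy [y0 ry0]]] := r_ccp.
have /choice[q gq] : forall i, exists y, (g i y < +oo)%E.
  by move=> i; have [_ _ [_ [y gy]]] := g_ccp i; exists y.
have lt_y : (lagrangian r f g x xs nu < +oo)%E.
  apply: le_lt_trans (minx y0 (\matrix_(i < n) q i)) _.
  rewrite lagrangianE lte_add_pinfty ?ltry // lte_add_pinfty //.
  rewrite lte_mul_pinfty // ?lee_fin ?(ltW nV_gt0) //.
  apply: lte_sum_pinfty => i _; rewrite rowK lte_add_pinfty //.
  by have [fq _] := f_diff i (q i); rewrite ltey_eq fq.
have sumNy : (\sum_(i < n) cost i (row i xs) != -oo)%E.
  apply/eqP => /esum_eqNyP[i [_ _ /eqP]]; apply/negP; exact: cost_gtNy.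
have : (r x + (n%:R^-1)%:E * \sum_(i < n) cost i (row i xs) \is a fin_num)%E.
  move: lt_y sumNy (rNy x); rewrite lagrangianE.
  case: (\sum_(i < n) _)%E => [a| |] //; case: (r x) => [b| |] //;
    by rewrite ?gt0_muley ?lte_fin.
rewrite fin_numD => /andP[-> fs]; split=> // i.
have : (\sum_(i < n) cost i (row i xs) \is a fin_num)%E.
  move: fs; case: (\sum_(i < n) _)%E => [a| |] //.
    by rewrite gt0_muley.
  by rewrite gt0_muleNy.
by move/sum_fin_numP; apply; rewrite // mem_index_enum.
Qed.

(** Otherwise moving the multipliers along the constraint violation would increase
    the Lagrangian. *)
Lemma saddle_point_feasible x xs nu :
  saddle_point r f g x xs nu -> xs = consensus x.
Proof.
move=> sp; have [frx fcost] := saddle_point_finite sp; have [_ maxnu] := sp.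
have := maxnu (nu + (xs - consensus x)); rewrite !lagrangianE leeD2lE; last first.
  rewrite fin_numD frx fin_numM //; apply/sum_fin_numP => i _ _; exact: fcost.
rewrite lee_fin ler_pM2l // innerDl gerDl -norm2_sqr => le0.
apply/eqP; rewrite -subr_eq0; apply/eqP/norm2_eq0/eqP.
by rewrite -sqrf_eq0 eq_le le0 sqr_ge0.
Qed.

(** Minimality in [x] alone and in a single row of [xs] alone gives one subgradient
    inequality each; in the latter the smooth term [f i] enters through its
    gradient. *)
Lemma saddle_point_subgrad x xs nu : saddle_point r f g x xs nu ->
  subgrad r x (mean nu) /\
  forall i, subgrad (g i) x (- (grad (f i) x + row i nu)).
Proof.
move=> sp; have [frx fcost] := saddle_point_finite sp.
have xsE := saddle_point_feasible sp; have [minx _] := sp.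
have fsum : ((n%:R^-1)%:E * \sum_(i < n) cost i (row i xs) \is a fin_num)%E.
  by rewrite fin_numM //; apply/sum_fin_numP => i _ _; exact: fcost.
rewrite xsE in fcost minx fsum.
split=> [|i].
  split=> // y; have := minx y (consensus x); rewrite !lagrangianE.
  rewrite subrr inner0r mulr0 adde0 -consensusB inner_consensus //.
  rewrite mulKf ?pnatr_eq0 -?lt0n // -opprB innerNr.
  move: frx fsum; case: (r x) => [a| |] // _.
  case: (_ * _)%E => [s| |] // _; have [_ _ [/(_ y) + _]] := r_ccp.
  case: (r y) => [b| |] // _; last by move=> _; rewrite leey.
  rewrite -!EFinD !lee_fin; lra.
have [fx fgx] : f i x \is a fin_num /\ g i x \is a fin_num.
  by have := fcost i; rewrite row_consensus fin_numD => /andP.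
(* The part of the Lagrangian, besides [g i], that depends on row [i]. *)
pose F y := fine (f i y) + inner (row i nu) (y - x).
apply: (@convex_first_order _ _ _ F) => // y.
  exists (L / 2 * norm2 (y - x) ^+ 2) => t t01.
  have -> : t *: y + (1 - t) *: x = x + t *: (y - x).
    by apply/rowP => j; rewrite !mxE; ring.
  have := @descent_lemma _ _ (fine \o f i) L x (t *: (y - x))
    (fun y => (f_diff i y).2) (f_lip i).
  rewrite /F norm2Z exprMn real_normK ?num_real // innerDl /= !innerZr.
  rewrite -/(grad (f i) x) subrr inner0r.
  have -> : x + t *: (y - x) - x = t *: (y - x) by rewrite addrC addKr.
  rewrite innerZr; lra.
pose ys : 'M[R]_(n, d) := \matrix_(j < n) (if j == i then y else x).
have ys_i : row i ys = y by rewrite rowK eqxx.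
have ys_j j : j != i -> row j ys = x by rewrite rowK => /negbTE ->.
have := minx x ys; rewrite !lagrangianE subrr inner0r mulr0 adde0.
have -> : inner nu (ys - consensus x) = inner (row i nu) (y - x).
  rewrite inner_rows (bigD1 i) //= big1 ?addr0 => [|j ji].
    by rewrite rowB ys_i row_consensus.
  by rewrite rowB ys_j // row_consensus subrr inner0r.
rewrite [in X in (X <= _)%E](bigD1 i) //= [in X in (_ <= X)%E](bigD1 i) //=.
have -> : (\sum_(j < n | j != i) cost j (row j ys) =
    \sum_(j < n | j != i) cost j (row j (consensus x)))%E.
  by apply: eq_bigr => j ji; rewrite ys_j // row_consensus.
have : (\sum_(j < n | j != i) cost j (row j (consensus x)) \is a fin_num)%E.
  by apply/sum_fin_numP => j _ _; exact: fcost.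
move: (\sum_(j < n | j != i) _)%E => C; rewrite ys_i row_consensus /cost /F.
have [fy _] := f_diff i y; rewrite -(fineK fy) -(fineK fx) /=.
move: (fine (f i y)) (fine (f i x)) => b a; rewrite subrr inner0r addr0.
have [_ _ [/(_ y) + _]] := g_ccp i.
move: frx fgx; case: (r x) => [c| |] // _; case: (g i x) => [e| |] // _.
case: (g i y) => [l| |] // _; last by move=> _ _; rewrite addye // leey.
case: C => [s| |] // _; rewrite -!EFinD !lee_fin.
move=> le_y; suff : a + e + s <= b + l + s + inner (row i nu) (y - x) by lra.
by rewrite -(ler_pM2l nV_gt0) [leRHS]mulrDr; lra.
Qed.

(** With [w_i = x + alpha * nu_i], the subgradients at a saddle point are the
    optimality conditions of the proximal steps taken from [w]. *)
Lemma saddle_point_residual_eq0 x xs nu : saddle_point r f g x xs nu ->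
  residual (consensus x + alpha *: nu) = 0.
Proof.
move=> /saddle_point_subgrad[sub_r sub_g]; set w := _ + _.
have mean_w : mean w = x + alpha *: mean nu.
  by rewrite /w meanD mean_consensus // meanZ.
have half_w : half w = x.
  apply: subgrad_prox; rewrite mean_w addrAC subrr add0r.
  by apply/subgradZ => //; rewrite scalerA mulVf ?scale1r // gt_eqF.
apply/row_matrixP => i; rewrite row_split_residual row0 -/(half w) half_w.
apply/eqP; rewrite subr_eq0 eq_sym; apply/eqP; apply: subgrad_prox.
apply/subgradZ => //; move: (sub_g i); congr subgrad.
rewrite /w /G /gradient_step; move: (grad _ _) => gx.
by apply/rowP => j; rewrite !mxE; field; rewrite gt_eqF.
Qed.

End FixedPoints.

(** * Convergence of the method *)

Theorem theorem1 (R : realType) (d n : nat) (n_gt0 : (0 < n)%N)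
    (r : 'rV[R]_d -> \bar R) (f g : 'I_n -> 'rV[R]_d -> \bar R)
    (L alpha : R)
    (r_ccp : ccp r)
    (f_ccp : forall i, ccp (f i))
    (g_ccp : forall i, ccp (g i))
    (L_gt0 : 0 < L)
    (f_diff : forall i, differentiable_fun (f i))
    (f_lip : forall i, lipschitz_grad L (f i))
    (saddle : exists x xs nu, saddle_point r f g x xs nu)
    (alpha_gt0 : 0 < alpha) (alpha_lt : alpha < 3 / (2 * L))
    (z : nat -> 'M[R]_(n, d)) (xh : nat -> 'rV[R]_d)
    (xs : nat -> 'M[R]_(n, d))
    (zgen : ppg_generated r f g alpha z xh xs) :
  [/\ (forall k, norm2 (ppg_p r f g alpha (z k.+1))
                 <= norm2 (ppg_p r f g alpha (z k))),
      (fun k => norm2 (ppg_p r f g alpha (z k))) @ \oo --> (0 : R),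
      (fun k => norm2 (ppg_p r f g alpha (z k)))
        =O_\oo (fun k => (Num.sqrt k%:R)^-1 : R) &
      exists zstar, exists xstar,
        [/\ ppg_fixed_point r f g alpha zstar,
            argmin (objective r f g) xstar,
            z @ \oo --> zstar,
            xh @ \oo --> xstar &
            forall i, (fun k => row i (xs k.+1)) @ \oo --> xstar]].
Proof.
pose P := prox_r r alpha; pose Q := prox_g g alpha.
pose G := gradient_step f alpha; pose next := split_next P Q G.
pose c := 1 - alpha * L / 2.
have c_gt0 : 0 < c.
  by move: alpha_lt; rewrite ltr_pdivlMr ?mulr_gt0 // /c; lra.
have averaged u w : norm2 (next u - next w) ^+ 2 <= norm2 (u - w) ^+ 2 -
    c * norm2 ((u - next u) - (w - next w)) ^+ 2.
  apply: split_next_averaged => //.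
  - exact: mulr_gt0.
  - exact: prox_firmly_nonexpansive.
  - by move=> i; exact: prox_firmly_nonexpansive.
  - exact: step_cocoercive.
have zgenE := ppg_generated_split zgen.
have z_iter k : z k.+1 = next (z k) by have [] := zgenE k.
have [x0 [xs0 [nu0 sp]]] := saddle.
have res0 := saddle_point_residual_eq0 n_gt0 r_ccp g_ccp f_diff f_lip alpha_gt0 sp.
have fix0 : next (consensus x0 + alpha *: nu0) = consensus x0 + alpha *: nu0.
  by rewrite /next /split_next res0 subr0.
have pE k : norm2 (ppg_p r f g alpha (z k)) = alpha^-1 * norm2 (z k - next (z k)).
  by rewrite subKr -scale_ppg_p // norm2Z gtr0_norm // mulKf // gt_eqF.
have alphaV_gt0 : 0 < alpha^-1 by rewrite invr_gt0.
have [p_mono p_to0 p_rate] :=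
  scaled_residual_rate c_gt0 averaged z_iter fix0 alphaV_gt0 pE.
split=> //.
have [w fixw zw] := averaged_converges c_gt0 averaged z_iter fix0.
have resw : split_residual P Q G w = 0.
  move/eqP: fixw; rewrite -subr_eq0 /next /split_next addrAC subrr sub0r.
  by rewrite oppr_eq0 => /eqP.
have xhw e : 0 < e -> exists N, forall k, (N <= k)%N ->
    norm2 (xh k - split_half P w) < e.
  move=> /zw[N zN]; exists N => k /zN; have [_ -> _] := zgenE k.
  apply: le_lt_trans; apply: split_half_nonexpansive => //.
  exact: prox_firmly_nonexpansive.
exists w, (split_half P w); split.
- exact: residual_eq0_fixed resw.
- exact: (residual_eq0_argmin n_gt0 r_ccp f_ccp g_ccp f_diff alpha_gt0 resw).
- exact: norm2_cvg.
- exact: norm2_cvg.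
- move=> i; apply: norm2_cvg => e e0.
  have e2 : 0 < e / 2 by rewrite divr_gt0.
  have [N1 xN] := xhw _ e2.
  have [N2 resN] := residual_vanishes c_gt0 averaged z_iter fix0 e2.
  exists (maxn N1 N2) => k; rewrite geq_max => /andP[/xN + /resN].
  have [_ _ ->] := zgenE k; rewrite subKr addrAC.
  have := norm2D (xh k - split_half P w) (- row i (split_residual P Q G (z k))).
  have := norm2_row_le (split_residual P Q G (z k)) i; rewrite norm2N; lra.
Qed.
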